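(* Let $\mathcal A=\{n_1,n_2,n_3\}$ be a set of three positive integers with $\gcd(n_1,n_2,n_3)=1$, and let $d_{ij}=\gcd(n_i,n_j)$ for all $i\ne j$. Then the Graver complexity $g(\mathcal A)$ satisfies $$g(\mathcal A)\ \ge\ \frac{n_1}{d_{12}d_{13}}+\frac{n_2}{d_{12}d_{23}}+\frac{n_3}{d_{13}d_{23}}.$$ In particular, if $n_1,n_2,n_3$ are pairwise relatively prime then $g(\mathcal A)\ge n_1+n_2+n_3$.
   Context: $\mathbb N$ contains $0$. For an integer matrix $D$ with $N$ columns, let $\mathcal L(D)=\operatorname{Ker}_{\mathbb Z}(D)\subset\mathbb Z^N$. For $\mathbf u\in\mathbb Z^N$ write $\mathbf u=\mathbf u^+-\mathbf u^-$ with $\mathbf u^\pm\in\mathbb N^N$ of disjoint supports. The Graver basis of $D$ is the (finite) set of nonzero $\mathbf u\in\mathcal L(D)$ that cannot be written $\mathbf u=\mathbf v+\mathbf w$ with $\mathbf v,\mathbf w\in\mathcal L(D)$ nonzero, $\mathbf u^+=\mathbf v^++\mathbf w^+$ and $\mathbf u^-=\mathbf v^-+\mathbf w^-$. For $\mathcal A=\{n_1,n_2,n_3\}$ let $A=(n_1\ n_2\ n_3)$ and $\mathcal L(\mathcal A)=\operatorname{Ker}_{\mathbb Z}(A)$. For $r\ge2$ the $r$-th Lawrence lifting $\mathcal A^{(r)}$ is the $(r+3)\times 3r$ matrix consisting of the block-diagonal matrix with $r$ diagonal blocks $A$, followed below by the row of blocks $(I_3\ I_3\ \cdots\ I_3)$.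 An element of $\mathcal L(\mathcal A^{(r)})$ is identified with an $r\times 3$ integer matrix whose rows lie in $\mathcal L(\mathcal A)$ and sum to zero; its type is the number of its nonzero rows. The Graver complexity $g(\mathcal A)$ is the largest type of any vector in the Graver basis of $\mathcal A^{(r)}$, as $r\ge 2$ varies (it is known to be finite). *)

(* Defs.v *)
From mathcomp Require Import all_boot all_order all_algebra.
From mathcomp Require Import boolp classical_sets.
From mathcomp Require Import zify.

Set Implicit Arguments.
Unset Strict Implicit.
Unset Printing Implicit Defensive.

Import Order.TTheory GRing.Theory Num.Theory.
Local Open Scope ring_scope.

(* Vectors of Z^N are column vectors, so that [D *m u = 0] reads as
   u \in Ker_Z(D). *)
Definition in_kerZ (m N : nat) (D : 'M[int]_(m, N)) (u : 'cV[int]_N) : Prop :=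
  D *m u = 0.

Definition pospart (N : nat) (u : 'cV[int]_N) : 'cV[int]_N :=
  map_mx (fun x : int => Num.max x 0) u.

Definition negpart (N : nat) (u : 'cV[int]_N) : 'cV[int]_N :=
  map_mx (fun x : int => Num.max (- x) 0) u.

Definition graver (m N : nat) (D : 'M[int]_(m, N)) (u : 'cV[int]_N) : Prop :=
  [/\ in_kerZ D u, u != 0 &
      ~ exists v w : 'cV[int]_N,
          [/\ in_kerZ D v /\ v != 0, in_kerZ D w /\ w != 0, u = v + w,
              pospart u = pospart v + pospart w &
              negpart u = negpart v + negpart w]].

Definition lawrence (r m n : nat) (A : 'M[int]_(m, n)) :
    'M[int]_(\sum_(i < r) m + n, \sum_(j < r) n) :=
  col_mx (\mxblock_(i < r, j < r) (if i == j then A else 0))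
         (\mxrow_(j < r) (1%:M : 'M[int]_n)).

(* [submxcol u i] is the i-th block of length n of u, i.e. the i-th row of the
   r x n matrix identified with u. *)
Definition vec_type (r n : nat) (u : 'cV[int]_(\sum_(j < r) n)) : nat :=
  #|[set i : 'I_r | submxcol u i != 0]|.

Definition graver_type (m n : nat) (A : 'M[int]_(m, n)) (t : nat) : Prop :=
  exists (r : nat) (u : 'cV[int]_(\sum_(j < r) n)),
    [/\ (2 <= r)%N, graver (lawrence r A) u & vec_type u = t].

(* The default value 0 is only used when Ker_Z(A) = 0, in which case the Graver
   bases of all the Lawrence liftings are empty: see [graver_complexityP]. *)
Definition graver_complexity (m n : nat) (A : 'M[int]_(m, n)) : nat :=
  xget 0%N [set g : nat | graver_type A g /\
                          forall t, graver_type A t -> (t <= g)%N]%classic.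

Definition row3 (n1 n2 n3 : nat) : 'M[int]_(1, 3) :=
  \row_(j < 3) (nth 0%N [:: n1; n2; n3] j)%:Z.

Lemma lawrence_kerE r m n (A : 'M[int]_(m, n)) (u : 'cV[int]_(\sum_(j < r) n)) :
  in_kerZ (lawrence r A) u <->
  (forall i : 'I_r, in_kerZ A (submxcol u i)) /\ \sum_(i < r) submxcol u i = 0.
Proof.
rewrite /in_kerZ /lawrence mul_col_mx -{1 2}[u]submxcolK mul_mxblock_mxrow.
rewrite mul_mxrow_mxcol.
have blk i : \sum_(j < r) (if i == j then A else 0) *m submxcol u j =
             A *m submxcol u i.
  rewrite (bigD1 i) //= eqxx big1 ?addr0 // => j ji.
  by rewrite eq_sym (negPf ji) mul0mx.
rewrite (eq_mxcol blk).
have -> : \sum_(i < r) (1%:M *m submxcol u i) = \sum_(i < r) submxcol u i.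
  by apply: eq_bigr => i _; rewrite mul1mx.
have z : (0 : 'cV[int]_(\sum_(i < r) m + n)) = col_mx 0 0 by rewrite col_mx0.
split=> [|[h1 ->]].
  rewrite z => /eq_col_mx [h ->]; split=> // i.
  rewrite -(mxcolK (fun i => A *m submxcol u i) i) h.
  by apply/matrixP=> a b; rewrite !mxE.
have -> : \mxcol_(i < r) (A *m submxcol u i) = 0.
  by apply/mxcolP=> i; rewrite mxcolK h1; apply/matrixP=> a b; rewrite !mxE.
by rewrite col_mx0.
Qed.

Local Lemma dickson (X : eqType) (e : nat -> X -> nat) (k : nat) (S : X -> Prop) :
  exists B : seq X, {in B, forall b, S b} /\
    forall x, S x -> exists2 b, b \in B & forall i, (i < k)%N -> (e i b <= e i x)%N.
Proof.
elim: k S => [|k IH] S.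
  have [[x Sx]|nS] := pselect (exists x, S x).
    exists [:: x]; split=> [b|y _]; first by rewrite inE => /eqP->.
    by exists x; rewrite ?inE.
  by exists [::]; split=> // x Sx; case: nS; exists x.
have [B [BS Bx]] := IH S.
have hN : exists N, {in B, forall b, (e k b <= N)%N}.
  elim: B {BS Bx} => [|b B [N hN]]; first by exists 0%N.
  exists (maxn N (e k b)) => c; rewrite inE => /orP[/eqP->|/hN]; lia.
have [N {}hN] := hN.
have /choice[C hC] : forall a, exists Ca : seq X,
    {in Ca, forall b, S b /\ e k b = a} /\
    forall x, S x /\ e k x = a ->
      exists2 b, b \in Ca & forall i, (i < k)%N -> (e i b <= e i x)%N.
  by move=> a; apply: IH.
exists (B ++ flatten [seq C a | a <- iota 0 N]); split=> [b|x Sx].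
  rewrite mem_cat => /orP[/BS //|/flatten_mapP[a _ /(proj1 (hC a)) []]//].
have [xN|xN] := ltnP (e k x) N.
  have [b bC hb] := (hC (e k x)).2 x (conj Sx erefl).
  exists b; first by rewrite mem_cat; apply/orP; right; apply/flatten_mapP;
    exists (e k x); rewrite // mem_iota.
  move=> i; rewrite ltnS leq_eqVlt => /orP[/eqP->|/hb //].
  by rewrite ((hC _).1 _ bC).2.
have [b bB hb] := Bx x Sx.
exists b; first by rewrite mem_cat bB.
move=> i; rewrite ltnS leq_eqVlt => /orP[/eqP->|/hb //].
exact: leq_trans (hN _ bB) xN.
Qed.

Local Lemma dicksonF (I : finType) (X : eqType) (e : I -> X -> nat) (S : X -> Prop) :
  exists B : seq X, {in B, forall b, S b} /\
    forall x, S x -> exists2 b, b \in B & forall i, (e i b <= e i x)%N.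
Proof.
have [B [BS hB]] := dickson (fun k x =>
  if insub k is Some j then e (@enum_val I predT j) x else 0%N) #|I| S.
exists B; split=> // x /hB[b bB hb]; exists b => // i.
by have := hb (enum_rank i) (ltn_ord _); rewrite valK enum_rankK.
Qed.

Local Definition pp (b : bool) (x : int) : nat :=
  if b then `|Num.max x 0|%N else `|Num.max (- x) 0|%N.

Local Lemma ppE x : x = (pp true x)%:Z - (pp false x)%:Z.
Proof. by rewrite /pp; lia. Qed.

Local Lemma ppB b x y : (forall c, pp c x <= pp c y)%N ->
  (pp b y = pp b x + pp b (y - x))%N.
Proof. by move=> h; move: (h true) (h false); rewrite /pp; case: b; lia. Qed.

Local Lemma pp_split b x (a c : bool -> nat) : (forall d, pp d x = a d + c d)%N ->
  pp b ((a true)%:Z - (a false)%:Z) = a b.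
Proof. by move=> h; move: (h true) (h false); rewrite /pp; case: b; lia. Qed.

Local Lemma pp_eq0 x : (forall b, pp b x = 0%N) -> x = 0.
Proof. by move=> h; rewrite [x]ppE !h. Qed.

Local Lemma pp0 b : pp b 0 = 0%N.
Proof. by case: b; rewrite /pp; lia. Qed.

Local Lemma partsE N (u v w : 'cV[int]_N) :
  (pospart u = pospart v + pospart w /\ negpart u = negpart v + negpart w) <->
  (forall i b, pp b (u i 0%R) = pp b (v i 0%R) + pp b (w i 0%R))%N.
Proof.
split=> [[h1 h2] i b|h].
  have := congr1 (fun M : 'cV_N => M i 0) h1.
  have := congr1 (fun M : 'cV_N => M i 0) h2.
  by rewrite !mxE /pp; case: b; lia.
by split; apply/matrixP=> i j; rewrite ord1 !mxE;
  move: (h i true) (h i false); rewrite /pp; lia.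
Qed.

Local Definition nrm N (u : 'cV[int]_N) : nat :=
  \sum_(i < N) \sum_(b : bool) pp b (u i 0%R).

Local Lemma nrm_gt0 N (u : 'cV[int]_N) : u != 0 -> (0 < nrm u)%N.
Proof.
rewrite lt0n; apply: contraNneq => /eqP; rewrite sum_nat_eq0 => /forallP h.
apply/eqP/matrixP=> i j; rewrite ord1 mxE; apply: pp_eq0 => b.
by have := h i; rewrite /= sum_nat_eq0 => /forallP /(_ b) /eqP.
Qed.

Local Lemma nrmD N (u v w : 'cV[int]_N) :
  (forall i b, pp b (u i 0%R) = pp b (v i 0%R) + pp b (w i 0%R))%N ->
  (nrm u = nrm v + nrm w)%N.
Proof.
move=> h; rewrite /nrm -big_split; apply: eq_bigr => i _.
by rewrite -big_split; apply: eq_bigr => b _; rewrite h.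
Qed.

Lemma graver_exists m N (D : 'M[int]_(m, N)) :
  (exists2 u, in_kerZ D u & u != 0) -> exists u, graver D u.
Proof.
move=> [u]; have [k] := ubnP (nrm u); elim: k u => // k IH u uk Du u0.
have [Gu|nGu] := pselect (graver D u); first by exists u.
suff [v [w [[Dv v0] [Dw w0] e e1 e2]]] : exists v w : 'cV[int]_N,
    [/\ in_kerZ D v /\ v != 0, in_kerZ D w /\ w != 0, u = v + w,
        pospart u = pospart v + pospart w & negpart u = negpart v + negpart w].
  apply: (IH v) => //; move: uk (nrm_gt0 w0).
  by rewrite (nrmD ((partsE u v w).1 (conj e1 e2))); lia.
by apply: contrapT => h; apply: nGu.
Qed.

Local Lemma greedy (I : finType) (M : I -> nat) (c : nat) :
  (c <= \sum_i M i)%N ->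
  exists M' : I -> nat, (forall i, M' i <= M i)%N /\ \sum_i M' i = c.
Proof.
elim: c => [|c IH] cM; first by exists (fun=> 0%N); rewrite big1_eq.
have [M' [le e]] := IH (ltnW cM).
have [i lti] : exists i, (M' i < M i)%N.
  apply: contrapT => h; move: cM; rewrite -e ltnNge leq_sum // => i _.
  by rewrite leqNgt; apply/negP => lt; apply: h; exists i.
exists (fun j => M' j + (j == i))%N; split=> [j|].
  by case: eqP => [->|_]; rewrite ?addn1 // addn0.
rewrite big_split /= e (bigD1 i) //= eqxx big1 => [|j ji]; first by lia.
by rewrite (negPf ji).
Qed.

Lemma graver_type_bounded m n (A : 'M[int]_(m, n)) :
  exists B : nat, forall t, graver_type A t -> (t <= B)%N.
Proof.
have [G [GS hG]] := dicksonF
  (fun (p : 'I_n * bool) (u : 'cV[int]_n) => pp p.2 (u p.1 0%R))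
  (fun u => in_kerZ A u /\ u != 0).
pose k := size G; pose g (j : 'I_k) : 'cV[int]_n := nth 0 G j.
have gS j : in_kerZ A (g j) /\ g j != 0 by apply/GS/mem_nth.
have dec u : in_kerZ A u -> exists M : 'I_k -> nat,
    forall i b, (pp b (u i 0%R) = \sum_j M j * pp b (g j i 0%R))%N.
  have [d] := ubnP (nrm u); elim: d u => // d IH u ud Au.
  have [->|u0] := eqVneq u 0.
    by exists (fun=> 0%N) => i b; rewrite big1 // mxE pp0.
  have [x xG hx] := hG u (conj Au u0).
  have xk : (index x G < k)%N by rewrite index_mem.
  pose j0 := Ordinal xk; have gj0 : g j0 = x by rewrite /g nth_index.
  have hd i b : (pp b (u i 0%R) = pp b (x i 0%R) + pp b ((u - x) i 0%R))%N.
    by rewrite !mxE; apply: ppB => c; apply: (hx (i, c)).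
  have [] := IH (u - x).
  - by have := nrm_gt0 (GS _ xG).2; move: ud; rewrite (nrmD hd); lia.
  - by rewrite /in_kerZ mulmxBr Au (GS _ xG).1 subrr.
  move=> M hM; exists (fun j => M j + (j == j0))%N => i b.
  under eq_bigr do rewrite mulnDl.
  rewrite big_split /= hd hM addnC; congr addn.
  rewrite (bigD1 j0) //= eqxx mul1n gj0 big1 ?addn0 // => j jj.
  by rewrite (negPf jj).
have [C [CS hC]] := dicksonF (fun (j : 'I_k) (c : {ffun 'I_k -> nat}) => c j)
  (fun c => c != [ffun=> 0%N] /\ \sum_j g j *+ c j = 0).
exists (\max_(c <- C) \sum_j c j)%N => t [r [u [r2 [Lu u0 ndec] <-{t}]]].
have [Au su] := (lawrence_kerE A u).1 Lu.
have [M hM] := choice (fun i => dec _ (Au i)).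
have comb (M0 : 'I_k -> nat) (i : 'I_n) :
    (\sum_j g j *+ M0 j) i 0 =
    (\sum_j M0 j * pp true (g j i 0%R))%N%:Z - (\sum_j M0 j * pp false (g j i 0%R))%N%:Z.
  rewrite summxE !(big_morph Posz PoszD (erefl _)) -sumrB; apply: eq_bigr => j _.
  rewrite mulmxnE {1}[g j i 0]ppE; lia.
have uE i : submxcol u i = \sum_j g j *+ M i j.
  by apply/matrixP=> a b; rewrite ord1 comb -!hM -ppE.
pose c : {ffun 'I_k -> nat} := [ffun j => \sum_i M i j]%N.
have cS : c != [ffun=> 0%N] /\ \sum_j g j *+ c j = 0.
  split.
    apply: contra u0 => /eqP/ffunP c0; apply/eqP/mxcolP => i.
    rewrite uE submxcol0 big1 // => j _.
    have /eqP := c0 j; rewrite !ffunE sum_nat_eq0 => /forallP/(_ i)/eqP /= ->.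
    by rewrite mulr0n.
  rewrite -{2}su; under [RHS]eq_bigr do rewrite uE.
  rewrite exchange_big /=; apply: eq_bigr => j _.
  by rewrite ffunE -sumrMnr.
have [c0 c0C c0c] := hC c cS.
have [c00 c0g] := CS _ c0C.
have /choice[M' hM'] : forall j, exists F : 'I_r -> nat,
    (forall i, F i <= M i j)%N /\ (\sum_i F i)%N = c0 j.
  by move=> j; apply: greedy; have := c0c j; rewrite ffunE.
pose vr i := \sum_j g j *+ M' j i.
pose v : 'cV[int]_(\sum_(j < r) n) := \mxcol_(i < r) vr i.
have ppv i a b : pp b (vr i a 0%R) = (\sum_j M' j i * pp b (g j a 0%R))%N.
  rewrite comb.
  apply: (@pp_split b (submxcol u i a 0)
    (fun b => \sum_j M' j i * pp b (g j a 0%R))%N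
    (fun b => \sum_j (M i j - M' j i) * pp b (g j a 0%R))%N) => d.
  rewrite hM -big_split; apply: eq_bigr => j _ /=.
  by rewrite -mulnDl subnKC //; apply: (hM' j).1.
have entry (x : 'cV[int]_(\sum_(j < r) n)) s :
    x s 0 = submxcol x (tagnat.sig1 s) (tagnat.sig2 s) 0.
  by rewrite mxE tagnat.sig2K.
have conf s b : (pp b (v s 0%R) <= pp b (u s 0%R))%N.
  rewrite !entry mxcolK ppv hM; apply: leq_sum => j _.
  by rewrite leq_mul2r (hM' j).1 orbT.
have Lv : in_kerZ (lawrence r A) v.
  apply/lawrence_kerE; split=> [i|].
    rewrite mxcolK /in_kerZ mulmx_sumr big1 // => j _.
    by rewrite (raddfMn (mulmx A)) /= (gS j).1 mul0rn.
  under eq_bigr do rewrite mxcolK.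
  rewrite exchange_big -[RHS]c0g; apply: eq_bigr => j _.
  by rewrite /= sumrMnr (hM' j).2.
have v0 : v != 0.
  apply: contra c00 => /eqP vz; apply/eqP/ffunP => j; rewrite ffunE.
  rewrite -(hM' j).2; apply/eqP; rewrite sum_nat_eq0; apply/forallP => i /=.
  apply: contraTT (gS j).2 => nz; rewrite negbK; apply/eqP/matrixP=> a b.
  rewrite ord1 mxE; apply: pp_eq0 => d.
  have := ppv i a d.
  have -> : vr i = 0 by rewrite -(mxcolK vr i) -/v vz submxcol0.
  rewrite mxE pp0 => /esym/eqP; rewrite sum_nat_eq0 => /forallP/(_ j) /=.
  by rewrite muln_eq0 (negPf nz) => /eqP.
have uv : u = v.
  apply/eqP; rewrite -subr_eq0; apply: contrapT => /negP w0; apply: ndec.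
  exists v, (u - v).
  have [] := (partsE u v (u - v)).2 => [s b|e1 e2].
    have -> : (u - v) s 0 = u s 0 - v s 0 by move: (v) => y; rewrite !mxE.
    by apply: ppB => d; apply: conf.
  split=> //; last by rewrite addrC subrK.
  by split=> //; rewrite /in_kerZ mulmxBr Lu Lv subrr.
apply: leq_trans (leq_bigmax_seq _ c0C isT).
rewrite uv /vec_type -sum1_card big_mkcond /=.
under [X in (_ <= X)%N]eq_bigr do rewrite -(hM' _).2.
rewrite exchange_big; apply: leq_sum => i _.
rewrite inE mxcolK; case: ifP => // /negP nz; rewrite lt0n; apply/negP => /=.
rewrite sum_nat_eq0 => /forallP z; apply: nz; rewrite /vr big1 // => j _.
by rewrite (eqP (z j)) mulr0n.
Qed.

Lemma graver_complexityP m n (A : 'M[int]_(m, n)) :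
  (exists2 u, in_kerZ A u & u != 0) ->
  graver_type A (graver_complexity A) /\
  forall t, graver_type A t -> (t <= graver_complexity A)%N.
Proof.
move=> [u Au u0]; rewrite /graver_complexity.
set S := [set g | _]%classic.
suff : exists g, S g by move=> /(xgetPex 0%N).
have [w Gw] : exists w, graver (lawrence 2 A) w.
  apply: graver_exists.
  exists (\mxcol_(i < 2) (if i == 0 then u else - u)).
    apply/lawrence_kerE; split=> [i|].
      by rewrite mxcolK /in_kerZ; case: ifP; rewrite ?mulmxN Au ?oppr0.
    by rewrite !big_ord_recl big_ord0 !mxcolK /= addr0 subrr.
  apply: contra u0 => /eqP e.
  have := mxcolK (fun i : 'I_2 => if i == 0 then u else - u) 0.
  by rewrite e /= => <-; rewrite submxcol0.
have ex : exists t, `[< graver_type A t >].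
  by exists (vec_type w); apply/asboolP; exists 2%N, w.
have [B hB] := graver_type_bounded A.
have bnd t : `[< graver_type A t >] -> (t <= B)%N by move=> /asboolP/hB.
case: (ex_maxnP ex bnd) => g /asboolP Gg mx.
by exists g; split=> // t Gt; apply/mx/asboolP.
Qed.

(* Main.v *)
Require Import Defs.
From mathcomp Require Import all_boot all_order all_algebra.
From mathcomp Require Import zify.

Set Implicit Arguments.
Unset Strict Implicit.
Unset Printing Implicit Defensive.

Import Order.TTheory GRing.Theory Num.Theory.
Local Open Scope ring_scope.

(** The kernel of the r-th Lawrence lifting of A consists of the r-tuples of
    elements of Ker_Z(A) with sum zero. A conformal decomposition of such a tuple is a
    conformal decomposition of each row, and a row that lies in the Graver
    basis of A can only be split as itself plus zero. So a tuple of Graver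
    elements of A with sum zero is indecomposable as soon as no proper nonempty
    subfamily has sum zero; in other words a relation sum_j m_j g_j = 0 with
    m_j in N between Graver elements, minimal among such relations, yields a
    Graver element of type sum_j m_j ([graver_type_minimal_relation]).

    For A = (n1 n2 n3) write n1 = m1 d12 d13, n2 = m2 d12 d23,
    n3 = m3 d13 d23 ([gcd_factorization]). The three circuits of A are
      c1 = (0, d13 m3, - d12 m2),
      c2 = (- d23 m3, 0, d12 m1),
      c3 = (d23 m2, - d13 m1, 0),
    and m1 c1 + m2 c2 + m3 c3 = 0. They span a space of dimension 2, so their
    relations form a lattice of rank one, and (m1, m2, m3) generates it because
    the m_i are pairwise coprime ([circuit_relation_minimal]). This relation is
    therefore minimal, and m1 + m2 + m3 is the type of a Graver element. *)

(** * Graver elements of Lawrence liftings *)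

Lemma graver_split m N (D : 'M[int]_(m, N)) (u v w : 'cV[int]_N) :
  graver D u -> in_kerZ D v -> in_kerZ D w -> u = v + w ->
  pospart u = pospart v + pospart w -> negpart u = negpart v + negpart w ->
  v = 0 \/ w = 0.
Proof.
move=> [_ _ ndec] Dv Dw uvw up un.
have [->|v0] := eqVneq v 0; first by left.
have [->|w0] := eqVneq w 0; first by right.
by case: ndec; exists v, w.
Qed.

(** A conformal summand v of u picks out the set of indices i such that the
    i-th block of v is nonzero, and on that set v agrees with u. *)
Lemma graver_lawrence r m n (A : 'M[int]_(m, n)) (f : 'I_r -> 'cV[int]_n) :
  (0 < r)%N -> (forall i, graver A (f i)) -> \sum_i f i = 0 ->
  (forall S : {set 'I_r}, \sum_(i in S) f i = 0 -> S = set0 \/ S = setT) ->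
  graver (lawrence r A) (\mxcol_(i < r) f i).
Proof.
move=> r_gt0 Gf sum_f min_f; split.
- apply/lawrence_kerE; split=> [i|]; first by rewrite mxcolK; case: (Gf i).
  by rewrite -[RHS]sum_f; apply: eq_bigr => i _; rewrite mxcolK.
- have [_ + _] := Gf (Ordinal r_gt0); apply: contraNneq => f0.
  by rewrite -(mxcolK f (Ordinal r_gt0)) f0 submxcol0.
move=> [v [w [[Lv v0] [Lw w0] uvw up un]]].
have [Av sum_v] := (lawrence_kerE A v).1 Lv.
have [Aw _] := (lawrence_kerE A w).1 Lw.
have fE i : f i = submxcol v i + submxcol w i.
  by rewrite -(mxcolK f i) uvw; apply/matrixP=> a b; rewrite !mxE.
have splitf i : submxcol v i = 0 \/ submxcol w i = 0.
  apply: (graver_split (Gf i)) => //.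
    apply/matrixP=> a b; rewrite -(mxcolK f i).
    have := congr1 (fun M : 'cV[int]_(\sum_(j < r) n) => submxcol M i a b) up.
    by rewrite !mxE.
  apply/matrixP=> a b; rewrite -(mxcolK f i).
  have := congr1 (fun M : 'cV[int]_(\sum_(j < r) n) => submxcol M i a b) un.
  by rewrite !mxE.
pose S := [set i | submxcol v i != 0].
have sum_S : \sum_(i in S) f i = 0.
  rewrite -[RHS]sum_v [RHS](bigID (mem S)) /= [X in _ = _ + X]big1 ?addr0.
    apply: eq_bigr => i; rewrite inE => /eqP vi.
    by rewrite fE; case: (splitf i) => // ->; rewrite addr0.
  by move=> i; rewrite inE negbK => /eqP.
have [SE|SE] := min_f S sum_S.
  case/eqP: v0; apply/mxcolP=> i; rewrite submxcol0; apply/eqP.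
  by have := in_set0 i; rewrite -SE inE => /negbFE.
case/eqP: w0; apply/mxcolP=> i; rewrite submxcol0.
have : i \in S by rewrite SE inE.
by rewrite inE => /eqP vi; case: (splitf i).
Qed.

(** The rows are mu j copies of g j for each j. The sum over a set of rows
    depends only on how many copies of each g j it contains, so a subfamily
    with sum zero is a relation bounded by mu. *)
Lemma graver_type_minimal_relation m n (A : 'M[int]_(m, n)) k
    (g : 'I_k -> 'cV[int]_n) (mu : 'I_k -> nat) :
  (forall j, graver A (g j)) -> (2 <= \sum_j mu j)%N ->
  \sum_j g j *+ mu j = 0 ->
  (forall a : 'I_k -> nat, (forall j, a j <= mu j)%N ->
     \sum_j g j *+ a j = 0 -> a =1 (fun=> 0%N) \/ a =1 mu) ->
  graver_type A (\sum_j mu j).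
Proof.
move=> Gg mu_ge2 sum_g min_g.
pose kind (s : 'I_(\sum_j mu j)) : 'I_k := tagnat.sig1 s.
pose mult (S : {set 'I_(\sum_j mu j)}) (j : 'I_k) :=
  #|[set s in S | kind s == j]|.
have sum_mult (S : {set 'I_(\sum_j mu j)}) :
    \sum_(s in S) g (kind s) = \sum_j g j *+ mult S j.
  rewrite (partition_big kind predT) //=; apply: eq_bigr => j _.
  rewrite (eq_bigr (fun=> g j)) => [|s /andP[_ /eqP->//]].
  by rewrite sumr_const; congr (_ *+ _); apply: eq_card => s; rewrite !inE.
have multT j : mult setT j = mu j.
  have Rank_inj : injective (@tagnat.Rank _ mu j).
    by move=> x y /(congr1 val)/eqP; rewrite tagnat.eq_Rank eqxx => /eqP/val_inj.
  rewrite /mult -[RHS]card_ord -(card_imset _ Rank_inj).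
  apply: eq_card => s; rewrite !inE /=; apply/eqP/imsetP => [<-|[x _ ->]].
    by exists (tagnat.sig2 s); rewrite // tagnat.sig2K.
  by rewrite /kind tagnat.Rank1K.
exists (\sum_j mu j)%N, (\mxcol_s g (kind s)); split=> //; last first.
  rewrite /vec_type -[RHS]card_ord; apply: eq_card => s.
  by rewrite !inE mxcolK; case: (Gg (kind s)).
apply: graver_lawrence => //; first exact: ltnW.
  transitivity (\sum_(s in [set: 'I_(\sum_j mu j)]) g (kind s)).
    by apply: eq_bigl => s; rewrite inE.
  by rewrite sum_mult -[RHS]sum_g; apply: eq_bigr => j _; rewrite multT.
move=> S; rewrite sum_mult => sum_S.
have leS (j : 'I_k) : (mult S j <= mu j)%N.
  by rewrite -multT; apply/subset_leq_card/subsetP => s; rewrite !inE => /andP[].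
have [S0|Smu] := min_g _ leS sum_S; [left|right].
  apply/setP=> s; rewrite inE; apply/negP=> sS.
  have := S0 (kind s); rewrite /mult => /eqP; rewrite cards_eq0 => /eqP/setP/(_ s).
  by rewrite !inE sS eqxx.
apply/setP=> s; rewrite inE.
have : [set t in S | kind t == kind s] == [set t in setT | kind t == kind s].
  rewrite eqEcard; apply/andP; split.
    by apply/subsetP => t; rewrite !inE => /andP[].
  by have := multT (kind s); have := Smu (kind s); rewrite /mult => -> ->.
by move=> /eqP/setP/(_ s); rewrite !inE eqxx andbT.
Qed.

(** * Circuits of a row of positive integers *)

Definition circuit N (i k : 'I_N) (p q : nat) : 'cV[int]_N :=
  p%:Z *: delta_mx i 0 - q%:Z *: delta_mx k 0.

Lemma circuitE N (i k : 'I_N) p q s :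
  circuit i k p q s 0 = p%:Z *+ (s == i) - q%:Z *+ (s == k).
Proof. by rewrite !mxE eqxx !andbT !mulr_natr. Qed.

(** A conformal summand of p e_i - q e_k has the form x e_i - y e_k with
    0 <= x <= p and x q = p y, and coprimality leaves only x = 0 and x = p. *)
Lemma circuit_graver N (n : 'I_N -> nat) (i k : 'I_N) (p q : nat) :
  i != k -> (0 < n i)%N -> (0 < p)%N -> coprime p q -> (n i * p = n k * q)%N ->
  graver (\row_j (n j)%:Z) (circuit i k p q).
Proof.
move=> ik ni_gt0 p_gt0 pq npq.
have kerE (u : 'cV[int]_N) : (forall s, s != i -> s != k -> u s 0 = 0) ->
    (\row_j (n j)%:Z *m u) 0 0 = (n i)%:Z * u i 0 + (n k)%:Z * u k 0.
  move=> u0; rewrite mxE (bigD1 i) //= (bigD1 k) /=; last by rewrite eq_sym.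
  rewrite big1 => [|s /andP[si sk]]; last by rewrite u0 ?mulr0.
  by rewrite !mxE addr0.
have ci : circuit i k p q i 0 = p%:Z.
  by rewrite circuitE eqxx (negPf ik) subr0.
have ck : circuit i k p q k 0 = - q%:Z.
  by rewrite circuitE eqxx eq_sym (negPf ik) sub0r.
have c0 s : s != i -> s != k -> circuit i k p q s 0 = 0.
  by move=> si sk; rewrite circuitE (negPf si) (negPf sk) subr0.
split.
- apply/matrixP=> a b; rewrite !ord1 kerE // ci ck mxE; lia.
- by apply/eqP => /matrixP/(_ i 0); rewrite ci mxE; lia.
move=> [v [w [[Av v0] [Aw w0] uvw up un]]].
have ent s : [/\ circuit i k p q s 0 = v s 0 + w s 0,
    Num.max (circuit i k p q s 0) 0 = Num.max (v s 0) 0 + Num.max (w s 0) 0 &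
    Num.max (- circuit i k p q s 0) 0 =
      Num.max (- v s 0) 0 + Num.max (- w s 0) 0].
  split.
  - by rewrite uvw mxE.
  - by have /matrixP/(_ s 0) := up; move: (circuit _ _ _ _) => c; rewrite !mxE.
  - by have /matrixP/(_ s 0) := un; move: (circuit _ _ _ _) => c; rewrite !mxE.
have v_supp s : s != i -> s != k -> v s 0 = 0.
  by move=> si sk; have [] := ent s; rewrite c0 //; lia.
have w_supp s : s != i -> s != k -> w s 0 = 0.
  by move=> si sk; have [] := ent s; rewrite c0 //; lia.
have := kerE _ v_supp; rewrite Av mxE => kv.
have [x vi [xp wi]] : exists2 x : nat, v i 0 = x%:Z &
    (x <= p)%N /\ w i 0 = p%:Z - x%:Z.
  by exists `|v i 0%R|%N; have [] := ent i; rewrite ci; lia.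
have [y vk wk] : exists2 y : nat, v k 0 = - y%:Z & w k 0 = y%:Z - q%:Z.
  by exists `|v k 0%R|%N; have [] := ent k; rewrite ck; lia.
have xy : (x * q = p * y)%N.
  move: kv; rewrite vi vk => kv.
  have nxy : (n i * x = n k * y)%N by lia.
  apply/eqP; rewrite -(eqn_pmul2l ni_gt0); apply/eqP.
  by rewrite mulnA nxy mulnA npq; lia.
have px : (p %| x)%N by rewrite -(Gauss_dvdl x pq) xy dvdn_mulr.
have [x0|xp'] : x = 0%N \/ x = p.
  have [->|x_gt0] := posnP x; first by left.
  by right; apply/eqP; rewrite eqn_leq xp dvdn_leq.
- have y0 : y = 0%N.
    by move: xy; rewrite x0 mul0n => /esym/eqP; rewrite muln_eq0; lia.
  case/eqP: v0; apply/matrixP=> s b; rewrite ord1 mxE.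
  have [->|si] := eqVneq s i; first by rewrite vi x0.
  have [->|sk] := eqVneq s k; first by rewrite vk y0.
  exact: v_supp.
have yq : y = q.
  by apply/eqP; rewrite -(eqn_pmul2l p_gt0) -xy xp'.
case/eqP: w0; apply/matrixP=> s b; rewrite ord1 mxE.
have [->|si] := eqVneq s i; first by rewrite wi xp' subrr.
have [->|sk] := eqVneq s k; first by rewrite wk yq subrr.
exact: w_supp.
Qed.

(** * The relation between the three circuits *)

(** The ratio of (a1, a2, a3) to (m1, m2, m3) is an integer, since coprimality
    of m1 and m2 makes m1 divide a1; the bound a1 <= m1 leaves 0 and 1. *)
Lemma coprime_proportional m1 m2 m3 a1 a2 a3 :
  (0 < m1)%N -> coprime m1 m2 -> (a1 <= m1)%N ->
  (a1 * m2 = a2 * m1)%N -> (a1 * m3 = a3 * m1)%N ->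
  [/\ a1 = 0%N, a2 = 0%N & a3 = 0%N] \/ [/\ a1 = m1, a2 = m2 & a3 = m3].
Proof.
move=> m1_gt0 co le1 e2 e3.
have dv : (m1 %| a1)%N by rewrite -(Gauss_dvdl a1 co) e2 dvdn_mull.
have [a0|a_gt0] := posnP a1; [left|right].
  move: e2 e3; rewrite a0 !mul0n => /esym/eqP + /esym/eqP.
  by rewrite !muln_eq0 (gtn_eqF m1_gt0) !orbF => /eqP-> /eqP->.
have am : a1 = m1 by apply/eqP; rewrite eqn_leq le1 dvdn_leq.
move: e2 e3; rewrite am ![(m1 * _)%N]mulnC => /eqP + /eqP.
by rewrite !(eqn_pmul2r m1_gt0) => /eqP<- /eqP<-.
Qed.

(** The circuits c1, c2, c3, with signs chosen cyclically so that the relation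
    between them has positive coefficients. *)
Definition circuits3 (d12 d13 d23 m1 m2 m3 : nat) (j : 'I_3) : 'cV[int]_3 :=
  nth 0 [:: circuit 1 2 (d13 * m3) (d12 * m2);
            circuit 2 0 (d12 * m1) (d23 * m3);
            circuit 0 1 (d23 * m2) (d13 * m1)] j.

Lemma sum_circuits3E d12 d13 d23 m1 m2 m3 (a : 'I_3 -> nat) :
  \sum_j circuits3 d12 d13 d23 m1 m2 m3 j *+ a j = 0 <->
  [/\ d23 * (a 2%R * m2) = d23 * (a 1%R * m3),
      d13 * (a 0%R * m3) = d13 * (a 2%R * m1)
    & d12 * (a 1%R * m1) = d12 * (a 0%R * m2)]%N.
Proof.
have o1 : lift ord0 ord0 = 1 :> 'I_3 by apply/val_inj.
have o2 : lift ord0 (lift ord0 ord0) = 2 :> 'I_3 by apply/val_inj.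
have E s : (\sum_j circuits3 d12 d13 d23 m1 m2 m3 j *+ a j) s 0 =
    circuit 1 2 (d13 * m3) (d12 * m2) s 0 *+ a 0
    + circuit 2 0 (d12 * m1) (d23 * m3) s 0 *+ a 1
    + circuit 0 1 (d23 * m2) (d13 * m1) s 0 *+ a 2.
  by rewrite summxE !big_ord_recl big_ord0 o1 o2 addr0 addrA !mulmxnE.
split=> [/matrixP e|[e0 e1 e2]].
  have := (e 0 0, e 1 0, e 2 0); rewrite !E !circuitE !mxE /= => -[[]].
  by split; lia.
apply/matrixP=> s b; rewrite ord1 E !circuitE mxE.
case: s => [[|[|[|//]]]] ? /=; lia.
Qed.

(** The coordinates of the relation say that a is proportional to
    (m1, m2, m3). *)
Lemma circuit_relation_minimal d12 d13 d23 m1 m2 m3 (a : 'I_3 -> nat) :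
  (0 < d12)%N -> (0 < d13)%N -> (0 < m1)%N -> coprime m1 m2 ->
  (a 0%R <= m1)%N ->
  \sum_j circuits3 d12 d13 d23 m1 m2 m3 j *+ a j = 0 ->
  a =1 (fun=> 0%N) \/ a =1 (fun j => nth 0%N [:: m1; m2; m3] j).
Proof.
move=> d12_gt0 d13_gt0 m1_gt0 co le0 /sum_circuits3E[_ /eqP + /eqP].
rewrite !eqn_pmul2l // => /eqP e2 /eqP e1.
have [[a0 a1 a2]|[a0 a1 a2]] :=
    coprime_proportional m1_gt0 co le0 (esym e1) e2; [left|right].
  by move=> s; case: s => [[|[|[|//]]]] ? /=;
    [rewrite -[RHS]a0|rewrite -[RHS]a1|rewrite -[RHS]a2];
    congr a; apply/val_inj.
by move=> s; case: s => [[|[|[|//]]]] ? /=;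
  [rewrite -[RHS]a0|rewrite -[RHS]a1|rewrite -[RHS]a2];
  congr a; apply/val_inj.
Qed.

(** The three gcds are pairwise coprime, a common divisor of two of them being
    a common divisor of n1, n2 and n3; hence d12 d13 divides n1, and so on.
    The coprimality conditions hold because n2 / d23 = m2 d12 and
    n3 / d23 = m3 d13, and likewise for the other two pairs. *)
Lemma gcd_factorization n1 n2 n3 :
  (0 < n1)%N -> (0 < n2)%N -> (0 < n3)%N -> gcdn n1 (gcdn n2 n3) = 1%N ->
  let d12 := gcdn n1 n2 in let d13 := gcdn n1 n3 in let d23 := gcdn n2 n3 in
  exists m1 m2 m3,
    [/\ n1 = m1 * (d12 * d13), n2 = m2 * (d12 * d23) & n3 = m3 * (d13 * d23)]%N /\
    [/\ coprime (d13 * m3) (d12 * m2), coprime (d12 * m1) (d23 * m3)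
      & coprime (d23 * m2) (d13 * m1)].
Proof.
move=> n1_gt0 n2_gt0 n3_gt0 gcd_n d12 d13 d23.
have d12_gt0 : (0 < d12)%N by rewrite gcdn_gt0 n1_gt0.
have d13_gt0 : (0 < d13)%N by rewrite gcdn_gt0 n1_gt0.
have d23_gt0 : (0 < d23)%N by rewrite gcdn_gt0 n2_gt0.
have co (x y : nat) : (gcdn x y %| gcdn n1 (gcdn n2 n3))%N -> coprime x y.
  by rewrite gcd_n dvdn1.
have dv12 : (d12 %| n1)%N && (d12 %| n2)%N by rewrite dvdn_gcdl dvdn_gcdr.
have dv13 : (d13 %| n1)%N && (d13 %| n3)%N by rewrite dvdn_gcdl dvdn_gcdr.
have dv23 : (d23 %| n2)%N && (d23 %| n3)%N by rewrite dvdn_gcdl dvdn_gcdr.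
have [[/andP[a1 a2] /andP[b1 b3]] /andP[c2 c3]] := ((dv12, dv13), dv23).
have co1 : coprime d12 d13.
  apply: co; rewrite !dvdn_gcd.
  by rewrite !(dvdn_trans (dvdn_gcdl _ _) a1, dvdn_trans (dvdn_gcdl _ _) a2,
    dvdn_trans (dvdn_gcdr _ _) b3).
have co2 : coprime d12 d23.
  apply: co; rewrite !dvdn_gcd.
  by rewrite !(dvdn_trans (dvdn_gcdl _ _) a1, dvdn_trans (dvdn_gcdl _ _) a2,
    dvdn_trans (dvdn_gcdr _ _) c3).
have co3 : coprime d13 d23.
  apply: co; rewrite !dvdn_gcd.
  by rewrite !(dvdn_trans (dvdn_gcdl _ _) b1, dvdn_trans (dvdn_gcdr _ _) c2,
    dvdn_trans (dvdn_gcdl _ _) b3).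
have /dvdnP[m1 e1] : (d12 * d13 %| n1)%N by rewrite Gauss_dvd // a1.
have /dvdnP[m2 e2] : (d12 * d23 %| n2)%N by rewrite Gauss_dvd // a2.
have /dvdnP[m3 e3] : (d13 * d23 %| n3)%N by rewrite Gauss_dvd // b3.
have quot (d x y : nat) : (0 < d)%N -> gcdn (d * x) (d * y) = d -> coprime x y.
  move=> d_gt0 /eqP; rewrite -muln_gcdr -{2}[d]muln1 eqn_pmul2l //.
exists m1, m2, m3; split=> //; split.
- apply: (quot d23) => //; rewrite -[RHS]gcdnC; congr gcdn;
    [rewrite [RHS]e3|rewrite [RHS]e2]; lia.
- apply: (quot d13) => //; congr gcdn;
    [rewrite [RHS]e1|rewrite [RHS]e3]; lia.
- apply: (quot d12) => //; rewrite -[RHS]gcdnC; congr gcdn;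
    [rewrite [RHS]e2|rewrite [RHS]e1]; lia.
Qed.

Theorem theorem4p2 (n1 n2 n3 : nat)
    (n1_gt0 : (0 < n1)%N) (n2_gt0 : (0 < n2)%N) (n3_gt0 : (0 < n3)%N)
    (gcd_n : gcdn n1 (gcdn n2 n3) = 1%N) :
  let d12 := gcdn n1 n2 in
  let d13 := gcdn n1 n3 in
  let d23 := gcdn n2 n3 in
  let g := graver_complexity (row3 n1 n2 n3) in
  n1%:R / (d12%:R * d13%:R) + n2%:R / (d12%:R * d23%:R)
    + n3%:R / (d13%:R * d23%:R) <= (g%:R : rat)
  /\ (coprime n1 n2 -> coprime n1 n3 -> coprime n2 n3 ->
      (n1 + n2 + n3 <= g)%N).
Proof.
move=> d12 d13 d23 g.
have [m1 [m2 [m3 [[e1 e2 e3] [co1 co2 co3]]]]] :=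
  gcd_factorization n1_gt0 n2_gt0 n3_gt0 gcd_n.
rewrite -/d12 -/d13 -/d23 in e1 e2 e3 co1 co2 co3.
have d12_gt0 : (0 < d12)%N by rewrite gcdn_gt0 n1_gt0.
have d13_gt0 : (0 < d13)%N by rewrite gcdn_gt0 n1_gt0.
have d23_gt0 : (0 < d23)%N by rewrite gcdn_gt0 n2_gt0.
have m1_gt0 : (0 < m1)%N by case: (m1) e1; lia.
have m2_gt0 : (0 < m2)%N by case: (m2) e2; lia.
have m3_gt0 : (0 < m3)%N by case: (m3) e3; lia.
pose c := circuits3 d12 d13 d23 m1 m2 m3.
have Gc j : graver (row3 n1 n2 n3) (c j).
  have row3E : row3 n1 n2 n3 = \row_(j < 3) (nth 0%N [:: n1; n2; n3] j)%:Z by [].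
  rewrite row3E /c /circuits3; case: j => [[|[|[|//]]]] ? /=;
    apply: circuit_graver => //=; rewrite ?muln_gt0 ?d12_gt0 ?d13_gt0 ?d23_gt0 //;
    (* the kernel condition, e.g. n2 d13 m3 = n3 d12 m2 for c1 *)
    rewrite ?[X in (X * _)%N]e1 ?[X in (X * _)%N]e2 ?[X in (X * _)%N]e3; lia.
pose mu (j : 'I_3) := nth 0%N [:: m1; m2; m3] j.
have sum_mu : (\sum_j mu j = m1 + m2 + m3)%N.
  by rewrite !big_ord_recl big_ord0 /mu /=; lia.
have type_mu : graver_type (row3 n1 n2 n3) (\sum_j mu j).
  apply: (graver_type_minimal_relation Gc); first by rewrite sum_mu; lia.
    by apply/sum_circuits3E; rewrite /mu /=; split; lia.
  have co12 : coprime m1 m2.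
    by move: co3; rewrite coprime_sym coprimeMl !coprimeMr => /andP[_ /andP[]].
  move=> a le_a.
  exact: (circuit_relation_minimal d12_gt0 d13_gt0 m1_gt0 co12 (le_a 0)).
have mg : (m1 + m2 + m3 <= g)%N.
  rewrite -sum_mu; apply: (graver_complexityP _).2 type_mu.
  by case: (Gc 0) => A0 c0 _; exists (c 0).
have quot (n m d d' : nat) : (0 < d)%N -> (0 < d')%N -> n = (m * (d * d'))%N ->
    n%:R / (d%:R * d'%:R) = m%:R :> rat.
  move=> d_gt0 d'_gt0 ->; rewrite !natrM mulfK //.
  by rewrite mulf_neq0 // pnatr_eq0 -lt0n.
rewrite (quot n1 m1) // (quot n2 m2) // (quot n3 m3) //; split.
  by rewrite -!natrD ler_nat.
move=> /eqP c12 /eqP c13 /eqP c23; apply: leq_trans mg.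
by rewrite [X in (X + _ + _)%N]e1 [X in (_ + X + _)%N]e2 [X in (_ + _ + X)%N]e3
  /d12 /d13 /d23 c12 c13 c23 !muln1.
Qed.
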